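(* Let $S=\{(x,y)\in[0,1]^m\times[0,1]^n \mid x^{\top}Qy+a^{\top}x+b^{\top}y\ge c\}$ be a bipartite bilinear set, where $Q\in\mathbb{R}^{m\times n}$, $a\in\mathbb{R}^m$, $b\in\mathbb{R}^n$, $c\in\mathbb{R}$. Let $C\subseteq[m]$ and $D\subseteq[n]$, and let $\tilde x_i\in\{0,1\}$ for $i\in[m]\setminus C$ and $\tilde y_j\in\{0,1\}$ for $j\in[n]\setminus D$. Let $h$ be a concave function defined on $[0,1]^{|C|+|D|}$ and $r\in\mathbb{R}$, and assume that the inequality $h(x_C,y_D)\ge r$ is valid for the set $$\{(x,y)\in S \mid x_{[m]\setminus C}=\tilde x_{[m]\setminus C},\ y_{[n]\setminus D}=\tilde y_{[n]\setminus D}\},$$ and that this set is nonempty. Then, for any $k\in[m]\setminus C$, there exists a finite $f_k\in(-\infty,\infty)$ for which the inequality $$h(x_C,y_D)+f_kx_k\ge r+f_k\tilde x_k$$ is valid for $$\{(x,y)\in S \mid x_{([m]\setminus C)\setminus\{k\}}=\tilde x_{([m]\setminus C)\setminus\{k\}},\ y_{[n]\setminus D}=\tilde y_{[n]\setminus D}\}.$$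
   Context: $[n]=\{1,\dots,n\}$. For a vector $x$ and an index set $C$, $x_C$ denotes the subvector of components indexed by $C$. An inequality is valid for a set if every point of the set satisfies it. *)

(* Defs.v *)
From mathcomp Require Export all_boot all_order all_algebra.
From mathcomp Require Export all_classical all_reals all_analysis.

Set Implicit Arguments.
Unset Strict Implicit.
Unset Printing Implicit Defensive.

Import Order.TTheory GRing.Theory Num.Theory.

Local Open Scope classical_set_scope.
Local Open Scope ring_scope.

Definition unit_box (R : realType) (d : nat) : set 'cV[R]_d :=
  [set z | forall i, 0 <= z i ord0 <= 1].

Definition bipartite_bilinear (R : realType) (m n : nat) (Q : 'M[R]_(m, n))
    (a : 'cV[R]_m) (b : 'cV[R]_n) (c : R) : set ('cV[R]_m * 'cV[R]_n) :=
  [set p | [/\ @unit_box R m p.1, @unit_box R n p.2 &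
    (p.1^T *m Q *m p.2 + a^T *m p.1 + b^T *m p.2) ord0 ord0 >= c]].

(* The components of x indexed by C, listed in increasing order of index. *)
Definition subvec (R : realType) (n : nat) (C : {set 'I_n}) (x : 'cV[R]_n) :
    'cV[R]_#|C| :=
  \col_(i < #|C|) x (enum_val i) ord0.

Definition fix_on (R : realType) (m n : nat) (S : set ('cV[R]_m * 'cV[R]_n))
    (A : {set 'I_m}) (xt : 'cV[R]_m) (B : {set 'I_n}) (yt : 'cV[R]_n) :
    set ('cV[R]_m * 'cV[R]_n) :=
  [set p | [/\ S p, subvec A p.1 = subvec A xt & subvec B p.2 = subvec B yt]].

(* Only the values of h on D matter; h is a total function by convention. *)
Definition concave_on (R : realType) (d : nat) (D : set 'cV[R]_d)
    (h : 'cV[R]_d -> R) : Prop :=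
  @convex_function R 'cV[R]_d D (fun z => - h z).

(* Main.v *)
Require Import Defs.
From mathcomp Require Import ring lra.

(** Lifting by exact penalization.

    Write u = (x_C, y_D) and let g(u) be the value of the bilinear left-hand
    side when all other components are pinned at their prescribed values, so
    that the hypothesis reads: h(u) >= r whenever g(u) >= c.  Releasing x_k
    changes the left-hand side by (x_k - xt_k) times a quantity that is bounded
    on the box, say by L (lemma [partial_bounded]).  Hence a point feasible for
    the relaxed set satisfies c - g(u) <= L |x_k - xt_k|, and it suffices to
    find K >= 0 with

      h(u) + K (c - g(u)) >= r  for all u in the box such that g(u) <= c,

    that is, an exact penalty (lemma [exact_penalty]).  Then f_k = K L works if
    xt_k = 0 and f_k = - K L if xt_k = 1, since xt_k being an endpoint of [0,1]
    makes |x_k - xt_k| an affine function of x_k.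

    A concave h may have infinite slope at the boundary of the box, so h is not
    Lipschitz in general, and g need be neither convex nor concave.  The
    penalty is exact because g is affine in each single coordinate, which makes
    F = h + K (c - g) - r concave in each single coordinate.  Given a point
    with g <= c, move along one coordinate line: the part of the line that lies
    in the box and in {g <= c} is a segment whose endpoints are either on faces
    of the box or on the level set g = c, and by concavity F is nonnegative
    inside when it is nonnegative at these endpoints.  On g = c one has
    F = h - r >= 0 by hypothesis.  Repeating this coordinate by coordinate
    leaves only the vertices of the box (lemma [sublevel_vertex_principle]),
    and as there are finitely many of them, one K serves all those where
    g < c. *)

Set Implicit Arguments.
Unset Strict Implicit.

Import Order.TTheory GRing.Theory Num.Theory.

Local Open Scope classical_set_scope.
Local Open Scope ring_scope.

(** * Functions concave or affine in each coordinate *)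

Definition concave01 (R : realType) (f : R -> R) : Prop :=
  forall t p q : R, 0 <= t <= 1 -> 0 <= p <= 1 -> 0 <= q <= 1 ->
    t * f p + (1 - t) * f q <= f (t * p + (1 - t) * q).

Definition update (R : realType) (d : nat) (z : 'cV[R]_d) (i : 'I_d) (s : R) :
    'cV[R]_d :=
  \col_j (if j == i then s else z j ord0).

Definition coordinate_affine (R : realType) (d : nat) (g : 'cV[R]_d -> R) :=
  forall z i, exists u v, forall s, g (update z i s) = u + v * s.

Definition coordinate_concave (R : realType) (d : nat) (h : 'cV[R]_d -> R) :=
  forall z i, unit_box z -> concave01 (fun s => h (update z i s)).

Lemma concave01_ge0 (R : realType) (f : R -> R) (p s q : R) :
  concave01 f -> 0 <= p <= 1 -> 0 <= q <= 1 -> p <= s <= q ->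
  0 <= f p -> 0 <= f q -> 0 <= f s.
Proof.
move=> fconc p01 q01 /andP[ps sq] fp fq.
have [pq|pq] := eqVneq p q; first by have -> : s = p by lra.
have pq0 : 0 < q - p by rewrite subr_gt0 lt_neqAle pq (le_trans ps sq).
pose t := (q - s) / (q - p).
have t0 : 0 <= t by rewrite divr_ge0 ?subr_ge0//; lra.
have t1 : t <= 1 by rewrite ler_pdivrMr// mul1r; lra.
have t01 : 0 <= t <= 1 by rewrite t0.
have -> : s = t * p + (1 - t) * q by rewrite /t; field; lra.
apply: le_trans (fconc t p q t01 p01 q01).
by apply: addr_ge0; apply: mulr_ge0 => //; lra.
Qed.

(** A nonempty sublevel set of an affine function on [0,1] is an interval whose
    endpoints are 0, 1 or the point where the level is attained. *)
Lemma concave01_ge0_sublevel (R : realType) (f : R -> R) (u v c s : R) :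
  concave01 f ->
  (forall p, 0 <= p <= 1 -> u + v * p = c -> 0 <= f p) ->
  (u <= c -> 0 <= f 0) -> (u + v <= c -> 0 <= f 1) ->
  0 <= s <= 1 -> u + v * s <= c -> 0 <= f s.
Proof.
move=> fconc flev f0 f1 /andP[s0 s1] gs.
have i0 : 0 <= (0 : R) <= 1 by rewrite lexx ler01.
have i1 : 0 <= (1 : R) <= 1 by rewrite lexx ler01.
have [g0|g0] := leP u c; have [g1|g1] := leP (u + v) c.
- by apply: (@concave01_ge0 _ f 0 s 1); rewrite ?s0 ?s1; auto.
- (* The level c is attained at p, to the right of s. *)
  have v0 : 0 < v by lra.
  pose p := (c - u) / v.
  have pv : v * p = c - u by rewrite /p; field; lra.
  have p0 : 0 <= p by rewrite -(ler_pM2l v0); lra.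
  have p1 : p <= 1 by rewrite -(ler_pM2l v0); lra.
  have sp : s <= p by rewrite -(ler_pM2l v0); lra.
  have p01 : 0 <= p <= 1 by rewrite p0.
  apply: (@concave01_ge0 _ f 0 s p); rewrite ?s0 ?sp//; first exact: f0.
  by apply: flev => //; lra.
- (* The level c is attained at p, to the left of s. *)
  have v0 : 0 < - v by lra.
  pose p := (c - u) / v.
  have pv : v * p = c - u by rewrite /p; field; lra.
  have p0 : 0 <= p by rewrite -(ler_pM2l v0); lra.
  have p1 : p <= 1 by rewrite -(ler_pM2l v0); lra.
  have ps : p <= s by rewrite -(ler_pM2l v0); lra.
  have p01 : 0 <= p <= 1 by rewrite p0.
  apply: (@concave01_ge0 _ f p s 1); rewrite ?s1 ?ps//; last exact: f1.
  by apply: flev => //; lra.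
- have [s00|s00] := eqVneq s 0; first by move: gs; rewrite s00; lra.
  have sgt0 : 0 < s by rewrite lt_neqAle eq_sym s00.
  have c0 : 0 < s * (u + v - c) by apply: mulr_gt0; lra.
  have c1 : 0 <= (1 - s) * (u - c) by apply: mulr_ge0; lra.
  by lra.
Qed.

Lemma update_id (R : realType) (d : nat) (z : 'cV[R]_d) (i : 'I_d) :
  update z i (z i ord0) = z.
Proof. by apply/colP => j; rewrite mxE; case: eqP => // ->. Qed.

Lemma unit_box_update (R : realType) (d : nat) (z : 'cV[R]_d) (i : 'I_d) s :
  unit_box z -> 0 <= s <= 1 -> unit_box (update z i s).
Proof. by move=> zb s01 j; rewrite mxE; case: eqP => _; [|apply: zb]. Qed.

(** A minimum principle: the coordinates are pushed one at a time to an
    endpoint of their range within the sublevel set, which is 0, 1 or a point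
    of the level set. *)
Lemma sublevel_vertex_principle (R : realType) (d : nat)
    (f g : 'cV[R]_d -> R) (c : R) :
  coordinate_concave f -> coordinate_affine g ->
  (forall z, unit_box z -> g z = c -> 0 <= f z) ->
  (forall z : 'cV[R]_d, (forall i, z i ord0 = 0 \/ z i ord0 = 1) ->
     g z <= c -> 0 <= f z) ->
  forall z, unit_box z -> g z <= c -> 0 <= f z.
Proof.
move=> fconc gaff flev fvert z zb gz.
suff main l : (l <= d)%N -> forall z, unit_box z ->
    (forall i : 'I_d, (l <= i)%N -> z i ord0 = 0 \/ z i ord0 = 1) ->
    g z <= c -> 0 <= f z.
  by apply: (main d) => // i; rewrite leqNgt ltn_ord.
elim: l => [_ {zb gz}z zb zv gz|l IHl ld {zb gz}z zb zv gz].
  by apply: fvert => // i; apply: zv.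
pose i := Ordinal ld.
have [u [v guv]] := gaff z i.
have end01 e : 0 <= e <= 1 -> e = 0 \/ e = 1 -> u + v * e <= c ->
    0 <= f (update z i e).
  move=> e01 eE ge; apply: IHl; rewrite ?guv//; first exact: ltnW.
    exact: unit_box_update.
  move=> j lj; rewrite mxE; case: eqP => // /eqP ji; apply: zv.
  by rewrite ltn_neqAle lj andbT eq_sym.
have i0 : 0 <= (0 : R) <= 1 by rewrite lexx ler01.
have i1 : 0 <= (1 : R) <= 1 by rewrite lexx ler01.
rewrite -(update_id z i).
apply: (@concave01_ge0_sublevel _ (fun s => f (update z i s)) u v c).
- exact: fconc.
- by move=> p p01 gp; apply: flev; rewrite ?guv//; apply: unit_box_update.
- by move=> uc; apply: end01; rewrite ?mulr0 ?addr0; auto.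
- by move=> uc; apply: end01; rewrite ?mulr1; auto.
- exact: zb.
- by rewrite -guv update_id.
Qed.

(** The function h + K (c - g) - r is still concave in each coordinate, so it
    has to be checked only where g = c, where the penalty vanishes, and at the
    vertices with g < c, where a large K forces it to be nonnegative. *)
Lemma exact_penalty (R : realType) (d : nat) (h g : 'cV[R]_d -> R) (c r : R) :
  coordinate_concave h -> coordinate_affine g ->
  (forall z, unit_box z -> c <= g z -> r <= h z) ->
  exists2 K, 0 <= K &
    forall z, unit_box z -> g z <= c -> r <= h z + K * (c - g z).
Proof.
move=> hconc gaff hval.
pose vertex (w : {ffun 'I_d -> bool}) : 'cV[R]_d := \col_i (w i)%:R.
(* The slope is the penalty that makes z harmless; a vertex with g z = c
   contributes 0 to the sum, being divided by 0. *)
pose slope z := `|h z - r| / `|c - g z|.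
pose K := \sum_w slope (vertex w).
have slope_ge0 z : 0 <= slope z by rewrite divr_ge0.
exists K; first exact: sumr_ge0.
move=> z zb gz; rewrite -subr_ge0; move: z zb gz.
apply: (@sublevel_vertex_principle _ _
  (fun z => h z + K * (c - g z) - r) g c) => //.
- move=> z i zb t p q t01 p01 q01 /=.
  have [u [v guv]] := gaff z i; rewrite !guv.
  by have := hconc z i zb t p q t01 p01 q01; lra.
- move=> z zb gz; rewrite gz subrr mulr0 addr0 subr_ge0.
  by apply: hval; rewrite ?gz.
- move=> z z01; rewrite le_eqVlt => /orP[/eqP gz|gz].
    rewrite gz subrr mulr0 addr0 subr_ge0; apply: hval; rewrite ?gz// => i.
    by case: (z01 i) => ->; rewrite ?lexx ler01.
  have zE : z = vertex [ffun i => z i ord0 == 1].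
    apply/colP => i; rewrite !mxE ffunE.
    by case: (z01 i) => ->; rewrite ?eqxx// eq_sym oner_eq0.
  move: gz; rewrite zE; set w := [ffun _ => _]; rewrite -subr_gt0 => gw.
  have Kw : slope (vertex w) <= K.
    by rewrite /K (bigD1 w)//= lerDl sumr_ge0.
  have := ler_wpM2r (ltW gw) Kw.
  rewrite {1}/slope (gtr0_norm gw) divfK ?gt_eqF//.
  by have := lerNnormlW (lexx `|h (vertex w) - r|); lra.
Qed.

(** * The bilinear form with pinned components *)

Definition bilinear_form (R : realType) (m n : nat) (Q : 'M[R]_(m, n))
    (a : 'cV[R]_m) (b : 'cV[R]_n) (x : 'cV[R]_m) (y : 'cV[R]_n) : R :=
  (x^T *m Q *m y + a^T *m x + b^T *m y) ord0 ord0.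

Definition pin (R : realType) (d : nat) (C : {set 'I_d}) (xt x : 'cV[R]_d) :
    'cV[R]_d :=
  \col_i (if i \in C then x i ord0 else xt i ord0).

Lemma bilinear_formDl (R : realType) (m n : nat) (Q : 'M[R]_(m, n))
    (a : 'cV[R]_m) (b : 'cV[R]_n) (x e : 'cV[R]_m) (y : 'cV[R]_n) (s : R) :
  bilinear_form Q a b (x + s *: e) y =
  bilinear_form Q a b x y + (e^T *m (Q *m y + a)) ord0 ord0 * s.
Proof.
rewrite /bilinear_form linearD/= linearZ/= !mulmxDl !mulmxDr.
have -> : a^T *m (s *: e) = s *: (e^T *m a).
  apply/colP => i; rewrite ord1 !mxE big_distrr; apply: eq_bigr => l _ /=.
  by rewrite !mxE; ring.
have entryD (A B : 'M[R]_1) : (A + B) ord0 ord0 = A ord0 ord0 + B ord0 ord0.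
  by rewrite mxE.
have entryZ (A : 'M[R]_1) : (s *: A) ord0 ord0 = s * A ord0 ord0 by rewrite mxE.
by rewrite -!scalemxAl -(mulmxA e^T) !(entryD, entryZ); ring.
Qed.

(** Exchanging the two blocks of variables, so that what is shown in [x]
    transfers to [y]. *)
Lemma bilinear_form_tr (R : realType) (m n : nat) (Q : 'M[R]_(m, n))
    (a : 'cV[R]_m) (b : 'cV[R]_n) (x : 'cV[R]_m) (y : 'cV[R]_n) :
  bilinear_form Q a b x y = bilinear_form Q^T b a y x.
Proof.
have tr11 (A : 'M[R]_1) : A^T = A by apply/colP => i; rewrite ord1 mxE.
rewrite /bilinear_form [in RHS]addrAC -[x^T *m Q *m y]tr11.
by rewrite !trmx_mul trmxK mulmxA.
Qed.

Lemma bilinear_formDr (R : realType) (m n : nat) (Q : 'M[R]_(m, n))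
    (a : 'cV[R]_m) (b : 'cV[R]_n) (x : 'cV[R]_m) (y e : 'cV[R]_n) (s : R) :
  bilinear_form Q a b x (y + s *: e) =
  bilinear_form Q a b x y + (e^T *m (Q^T *m x + b)) ord0 ord0 * s.
Proof. by rewrite !(bilinear_form_tr Q) bilinear_formDl. Qed.

Lemma pinD (R : realType) (d : nat) (C : {set 'I_d}) (xt x e : 'cV[R]_d) s :
  pin C xt (x + s *: e) = pin C xt x + s *: pin C 0 e.
Proof. by apply/colP => i; rewrite !mxE; case: ifP => //; rewrite mulr0 addr0. Qed.

Lemma update_line (R : realType) (d : nat) (z : 'cV[R]_d) (i : 'I_d) (s : R) :
  update z i s = update z i 0 + s *: delta_mx i ord0.
Proof.
apply/colP => j; rewrite !mxE !eqxx andbT.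
by case: eqP => _; rewrite ?mulr1 ?mulr0 ?add0r ?addr0.
Qed.

(** A single coordinate belongs either to [x] or to [y], and the form is affine
    in each of the two blocks. *)
Lemma bilinear_form_pin_affine (R : realType) (m n : nat) (Q : 'M[R]_(m, n))
    (a : 'cV[R]_m) (b : 'cV[R]_n) (C : {set 'I_m}) (D : {set 'I_n})
    (xt : 'cV[R]_m) (yt : 'cV[R]_n) :
  coordinate_affine (fun z : 'cV[R]_(m + n) =>
    bilinear_form Q a b (pin C xt (usubmx z)) (pin D yt (dsubmx z))).
Proof.
move=> z l; case: (split_ordP l) => i ->.
- have dE : dsubmx (delta_mx (lshift n i) ord0 : 'cV[R]_(m + n)) = 0.
    by apply/colP => j; rewrite !mxE eq_rlshift.
  do 2!eexists; move=> s; rewrite update_line 2!linearD/= 2!linearZ/= dE.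
  by rewrite scaler0 addr0 pinD bilinear_formDl.
- have uE : usubmx (delta_mx (rshift m i) ord0 : 'cV[R]_(m + n)) = 0.
    by apply/colP => j; rewrite !mxE eq_lrshift.
  do 2!eexists; move=> s; rewrite update_line 2!linearD/= 2!linearZ/= uE.
  by rewrite scaler0 addr0 pinD bilinear_formDr.
Qed.

(** Reading [h] as a function of all m + n variables makes it constant in those
    outside [C] and [D]; this keeps [h] and the bilinear form on the same
    space. *)
Lemma subvec_concave (R : realType) (m n : nat) (C : {set 'I_m})
    (D : {set 'I_n}) (h : 'cV[R]_(#|C| + #|D|) -> R) :
  concave_on (@unit_box R (#|C| + #|D|)) h ->
  coordinate_concave (fun z : 'cV[R]_(m + n) =>
    h (col_mx (subvec C (usubmx z)) (subvec D (dsubmx z)))).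
Proof.
move=> hconc z i zb t p q /andP[t0 t1] p01 q01 /=.
pose G (w : 'cV[R]_(m + n)) := col_mx (subvec C (usubmx w)) (subvec D (dsubmx w)).
have Gb w : unit_box w -> G w \in @unit_box R (#|C| + #|D|).
  move=> wb; rewrite inE => j; case: (split_ordP j) => l ->.
    by rewrite col_mxEu !mxE; apply: wb.
  by rewrite col_mxEd !mxE; apply: wb.
have := hconc (Itv01 t0 t1) (G (update z i p)) (G (update z i q)).
move=> /(_ (Gb _ (unit_box_update i zb p01)) (Gb _ (unit_box_update i zb q01))).
rewrite -lerN2 opprK convN !opprK.
congr (_ <= h _).
apply/colP => j; rewrite !mxE.
by case: fintype.split => l; rewrite !mxE; case: eqP => _ //=;
  rewrite /unstable.onem; ring.
Qed.

(** The quantity bounded here is the partial derivative in [x k] of the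
    bilinear form. *)
Lemma partial_bounded (R : realType) (m n : nat) (Q : 'M[R]_(m, n))
    (a : 'cV[R]_m) (k : 'I_m) :
  exists2 L, 0 <= L & forall y, unit_box y ->
    `|((delta_mx k ord0 : 'cV[R]_m)^T *m (Q *m y + a)) ord0 ord0| <= L.
Proof.
exists (\sum_j `|Q k j| + `|a k ord0|) => [|y yb].
  by rewrite addr_ge0// sumr_ge0.
rewrite trmx_delta -rowE !mxE (le_trans (ler_normD _ _))// lerD2r.
rewrite (le_trans (ler_norm_sum _ _ _))// ler_sum// => j _.
have /andP[y0 y1] := yb j.
by rewrite normrM ler_piMr// ger0_norm.
Qed.

Lemma subvec_eqP (R : realType) (d : nat) (A : {set 'I_d}) (x xt : 'cV[R]_d) :
  subvec A x = subvec A xt <-> forall i, i \in A -> x i ord0 = xt i ord0.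
Proof.
split=> [E i iA|E]; last first.
  by apply/colP => i; rewrite !mxE E// enum_valP.
by have /colP/(_ (enum_rank_in iA i)) := E; rewrite !mxE enum_rankK_in.
Qed.

Lemma unit_box_pin (R : realType) (d : nat) (C : {set 'I_d}) (xt x : 'cV[R]_d) :
  (forall i, i \in ~: C -> xt i ord0 = 0 \/ xt i ord0 = 1) ->
  unit_box x -> unit_box (pin C xt x).
Proof.
move=> xt01 xb i; rewrite mxE; case: ifPn => [_|iC]; first exact: xb.
by case: (xt01 i) => [|->|->]; rewrite ?inE ?lexx ?ler01.
Qed.

Lemma subvec_pin (R : realType) (d : nat) (C : {set 'I_d}) (xt x : 'cV[R]_d) :
  subvec C (pin C xt x) = subvec C x.
Proof. by apply/subvec_eqP => i iC; rewrite mxE iC. Qed.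

Lemma subvec_pinC (R : realType) (d : nat) (C : {set 'I_d}) (xt x : 'cV[R]_d) :
  subvec (~: C) (pin C xt x) = subvec (~: C) xt.
Proof. by apply/subvec_eqP => i; rewrite inE mxE => /negPf ->. Qed.

(** * Lifting one variable *)

Unset Implicit Arguments.
Set Strict Implicit.

Theorem theorem1 (R : realType) (m n : nat)
    (Q : 'M[R]_(m, n)) (a : 'cV[R]_m) (b : 'cV[R]_n) (c : R)
    (C : {set 'I_m}) (D : {set 'I_n})
    (xt : 'cV[R]_m) (yt : 'cV[R]_n)
    (hxt : forall i, i \in ~: C -> xt i ord0 = 0 \/ xt i ord0 = 1)
    (hyt : forall j, j \in ~: D -> yt j ord0 = 0 \/ yt j ord0 = 1)
    (h : 'cV[R]_(#|C| + #|D|) -> R) (r : R)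
    (hconc : concave_on (@unit_box R (#|C| + #|D|)) h)
    (hvalid : forall x y,
       fix_on (bipartite_bilinear Q a b c) (~: C) xt (~: D) yt (x, y) ->
       h (col_mx (subvec C x) (subvec D y)) >= r)
    (hne : fix_on (bipartite_bilinear Q a b c) (~: C) xt (~: D) yt !=set0)
    (k : 'I_m) (hk : k \in ~: C) :
  exists f : R, forall x y,
    fix_on (bipartite_bilinear Q a b c) (~: C :\ k) xt (~: D) yt (x, y) ->
    h (col_mx (subvec C x) (subvec D y)) + f * x k ord0 >= r + f * xt k ord0.
Proof.
pose H (z : 'cV[R]_(m + n)) :=
  h (col_mx (subvec C (usubmx z)) (subvec D (dsubmx z))).
pose g (z : 'cV[R]_(m + n)) :=
  bilinear_form Q a b (pin C xt (usubmx z)) (pin D yt (dsubmx z)).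
have Hvalid z : unit_box z -> c <= g z -> r <= H z.
  move=> zb gz; have := hvalid (pin C xt (usubmx z)) (pin D yt (dsubmx z)).
  rewrite !subvec_pin; apply; split; rewrite ?subvec_pinC//; split => //=.
    by apply: unit_box_pin => // i; rewrite mxE; apply: zb.
  by apply: unit_box_pin => // i; rewrite mxE; apply: zb.
have [K K0 Kpen] := exact_penalty (subvec_concave hconc)
  (bilinear_form_pin_affine Q a b C D xt yt) Hvalid.
have [L L0 Lbound] := partial_bounded Q a k.
(* The deficit c - g of a point feasible for the relaxed set is at most
   L |x_k - xt_k|. *)
have penalty x y :
    fix_on (bipartite_bilinear Q a b c) (~: C :\ k) xt (~: D) yt (x, y) ->
    r <= h (col_mx (subvec C x) (subvec D y))
         + K * L * `|x k ord0 - xt k ord0|.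
  move=> [[/= xb yb gxy] /subvec_eqP xE /subvec_eqP yE].
  have yP : pin D yt y = y.
    apply/colP => j; rewrite mxE; case: ifPn => // jD.
    by rewrite -yE// inE.
  (* Among the components outside C, only the k-th may differ from xt. *)
  have xP : x = pin C xt x + (x k ord0 - xt k ord0) *: delta_mx k ord0.
    apply/colP => i; rewrite !mxE eqxx andbT; case: eqP => [->|/eqP ik].
      by move: hk; rewrite inE => /negPf ->; rewrite mulr1; lra.
    rewrite mulr0 addr0; case: ifPn => // iC.
    by rewrite xE// !inE ik.
  have zb : unit_box (col_mx x y).
    by move=> j; case: (split_ordP j) => l ->; rewrite ?col_mxEu ?col_mxEd.
  have HE : H (col_mx x y) = h (col_mx (subvec C x) (subvec D y)).
    by rewrite /H col_mxKu col_mxKd.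
  have gE : g (col_mx x y) = bilinear_form Q a b (pin C xt x) y.
    by rewrite /g col_mxKu col_mxKd yP.
  have pen0 : 0 <= K * L * `|x k ord0 - xt k ord0| by rewrite !mulr_ge0.
  have [gz|gz] := leP (g (col_mx x y)) c; last first.
    by have := Hvalid _ zb (ltW gz); rewrite HE; lra.
  have := Kpen _ zb gz; rewrite -/(H _) -/(g _) HE => Hz.
  apply: le_trans Hz _; rewrite lerD2l -mulrA ler_wpM2l//.
  have : c <= bilinear_form Q a b x y by [].
  rewrite [in X in _ <= X]xP bilinear_formDl -gE => cg.
  apply: (@le_trans _ _ `|((delta_mx k ord0 : 'cV[R]_m)^T *m (Q *m y + a)) ord0 ord0
     * (x k ord0 - xt k ord0)|).
    by rewrite (le_trans _ (ler_norm _))// lerBlDl.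
  by rewrite normrM ler_wpM2r// Lbound.
have [xk0|xk1] := hxt k hk.
- exists (K * L) => x y xy; have := penalty x y xy.
  have /andP[x0 x1] : 0 <= x k ord0 <= 1 by case: xy => -[].
  by rewrite xk0 subr0 ger0_norm//; lra.
- exists (- (K * L)) => x y xy; have := penalty x y xy.
  have /andP[x0 x1] : 0 <= x k ord0 <= 1 by case: xy => -[].
  by rewrite xk1 ler0_norm ?subr_le0//; lra.
Qed.
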